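(* The following (i)--(iv) hold. (i) The vector space $O$ has a basis consisting of the elements $$\mathcal A_k\ \ (k\in\mathbb Z),\qquad (\mathcal B_k-\mathcal B_{-k})/2\ \ (k\in\mathbb N^+).$$ (ii) The vector space $\mathcal Z$ has a basis consisting of the elements $$(\mathcal B_k+\mathcal B_{-k})/2\ \ (k\in\mathbb N^+).$$ (iii) The sum $\mathcal O=O+\mathcal Z$ is direct. (iv) $O$ is an ideal of $\mathcal O$.
   Context: $\mathbb F$ is a field of characteristic zero; all vector spaces and Lie algebras are over $\mathbb F$. $\mathbb N^+=\{1,2,3,\ldots\}$. $\mathbb F[t,t^{-1}]$ is the algebra of Laurent polynomials. $L(\mathfrak{gl}_2)=\mathfrak{gl}_2\otimes\mathbb F[t,t^{-1}]$ is the loop algebra, with Lie bracket $[u\otimes\varphi,v\otimes\phi]=[u,v]\otimes\varphi\phi$; its elements are viewed as $2\times 2$ matrices with entries in $\mathbb F[t,t^{-1}]$, with bracket $[x,y]=xy-yx$. $L(\mathfrak{sl}_2)=\mathfrak{sl}_2\otimes\mathbb F[t,t^{-1}]$ is the Lie subalgebra of trace-zero matrices. For $x=\begin{pmatrix} a(t)&b(t)\\ c(t)&d(t)\end{pmatrix}\in L(\mathfrak{gl}_2)$ define $\theta(x)=\begin{pmatrix} d(t^{-1})&c(t^{-1})\\ b(t^{-1})&a(t^{-1})\end{pmatrix}$ and $\varepsilon(x)=a(1)+d(1)\in\mathbb F$. Then $\theta$ is a Lie algebra automorphism of $L(\mathfrak{gl}_2)$ and $\varepsilon:L(\mathfrak{gl}_2)\to\mathbb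 F$ is a Lie algebra homomorphism ($\mathbb F$ abelian). Let $\mathcal L=\ker\varepsilon$. Let $O$ be the Lie algebra of all elements of $L(\mathfrak{sl}_2)$ fixed by $\theta$ (the Onsager Lie algebra), and let $\mathcal O$ be the Lie algebra of all elements of $\mathcal L$ fixed by $\theta$. Thus $O\subseteq\mathcal O$. Let $\mathcal Z$ be the center of $\mathcal O$. For $k\in\mathbb Z$ define $$\mathcal A_k=\begin{pmatrix}0&t^k\\ t^{-k}&0\end{pmatrix},\qquad \mathcal B_k=\begin{pmatrix}t^k-1&0\\ 0&t^{-k}-1\end{pmatrix}.$$ *)

(* Defs.v *)
From HB Require Import structures.
From mathcomp Require Import all_boot all_order all_algebra.
From mathcomp Require Import finmap.
From mathcomp.multinomials Require Import monalg.

Set Implicit Arguments.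
Unset Strict Implicit.
Unset Printing Implicit Defensive.

Import Order.TTheory GRing.Theory Num.Theory.

Local Open Scope ring_scope.

(* [{malg F[int]}] is the F-space of finitely supported functions on [int].
   It carries no product in monalg, because [int] is not a [monomType] (these
   are required to have no invertible element besides 1), so the group-algebra
   (convolution) product is defined below. *)
Definition laurent (F : fieldType) : Type := {malg F[int]}.

HB.instance Definition _ (F : fieldType) :=
  GRing.Lmodule.copy (laurent F) {malg F[int]}.

Section LaurentRing.
Variable F : fieldType.
Implicit Types (g : laurent F) (k : int).

Local Open Scope fset_scope.

Definition laurentX k : laurent F := << 1 *g k >>.

Definition laurent_mul g1 g2 : laurent F :=
  \sum_(k1 <- msupp g1) \sum_(k2 <- msupp g2)
    << g1@_k1 * g2@_k2 *g (k1 + k2)%R >>.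

Lemma laurent_mulw (d1 d2 : {fset int}) g1 g2 :
    msupp g1 `<=` d1 -> msupp g2 `<=` d2 ->
  laurent_mul g1 g2 =
    \sum_(k1 <- d1) \sum_(k2 <- d2) << g1@_k1 * g2@_k2 *g (k1 + k2)%R >>.
Proof.
move=> le_d1 le_d2; rewrite /laurent_mul (big_fset_incl _ le_d1) /=.
  apply/eq_bigr=> k1 _; apply/big_fset_incl => // k _ /mcoeff_outdom ->.
  by rewrite mulr0 monalgU0.
move=> k _ /mcoeff_outdom g1k.
by rewrite big1 => // k' _; rewrite g1k mul0r monalgU0.
Qed.

Lemma laurent_mulC : commutative laurent_mul.
Proof.
move=> g1 g2; rewrite /laurent_mul exchange_big /=.
by apply/eq_bigr=> k2 _; apply/eq_bigr=> k1 _; rewrite mulrC addrC.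
Qed.

Lemma laurent_mulDl : left_distributive laurent_mul +%R.
Proof.
move=> g1 g2 g.
rewrite [in RHS](laurent_mulw (fsubsetUl _ (msupp g2)) (fsubset_refl _)).
rewrite [in RHS](laurent_mulw (fsubsetUr (msupp g1) _) (fsubset_refl _)).
rewrite (laurent_mulw (msuppD_le _ _) (fsubset_refl _)).
rewrite -big_split /=; apply/eq_bigr=> k1 _.
rewrite -big_split /=; apply/eq_bigr=> k2 _.
by rewrite mcoeffD mulrDl monalgUD.
Qed.

Lemma laurent_mul0 : left_zero 0 laurent_mul.
Proof. by move=> g; rewrite /laurent_mul msupp0 big_seq_fset0. Qed.

Lemma laurent_mulUU c1 c2 k1 k2 :
  laurent_mul << c1 *g k1 >> << c2 *g k2 >> = << c1 * c2 *g (k1 + k2)%R >>.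
Proof.
by rewrite (laurent_mulw msuppU_le msuppU_le) !big_seq_fset1 !mcoeffUU.
Qed.

Lemma laurent_mul_suml (I : Type) (r : seq I) (P : pred I)
    (f : I -> laurent F) g :
  laurent_mul (\sum_(i <- r | P i) f i) g =
    \sum_(i <- r | P i) laurent_mul (f i) g.
Proof.
exact: (big_morph (laurent_mul^~ g) (fun _ _ => laurent_mulDl _ _ _)
  (laurent_mul0 g)).
Qed.

Lemma laurent_mul_sumr (I : Type) (r : seq I) (P : pred I)
    (f : I -> laurent F) g :
  laurent_mul g (\sum_(i <- r | P i) f i) =
    \sum_(i <- r | P i) laurent_mul g (f i).
Proof.
rewrite laurent_mulC laurent_mul_suml.
by apply: eq_bigr => i _; rewrite laurent_mulC.
Qed.

Lemma laurentE g : g = \sum_(k <- msupp g) (<< g@_k *g k >> : laurent F).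
Proof. exact: monalgE. Qed.

Lemma laurent_mulA : associative laurent_mul.
Proof.
move=> g1 g2 g3; rewrite {1 2}[g1]laurentE !laurent_mul_suml.
apply: eq_bigr => k1 _; rewrite {1 2}[g2]laurentE.
rewrite laurent_mul_suml !laurent_mul_sumr laurent_mul_suml.
apply: eq_bigr => k2 _; rewrite {1 2}[g3]laurentE !laurent_mul_sumr.
by apply: eq_bigr => k3 _; rewrite !laurent_mulUU mulrA addrA.
Qed.

Lemma laurent_mul1 : left_id (laurentX 0) laurent_mul.
Proof.
move=> g; rewrite [g in LHS]laurentE laurent_mul_sumr [RHS]laurentE.
by apply: eq_bigr => k _; rewrite laurent_mulUU mul1r add0r.
Qed.

Lemma laurentX0_neq0 : laurentX 0 != 0.
Proof. by rewrite monalgU_eq0 oner_eq0. Qed.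

HB.instance Definition _ := GRing.Zmodule_isComNzRing.Build (laurent F)
  laurent_mulA laurent_mulC laurent_mul1 laurent_mulDl laurentX0_neq0.

Lemma laurent_scaleAl (c : F) (g1 g2 : laurent F) :
  c *: (g1 * g2) = (c *: g1) * g2.
Proof.
have scaleE g : c *: g = (<< c *g (0 : int) >> : laurent F) * g.
  rewrite [g in LHS]laurentE [g in RHS]laurentE scaler_sumr.
  rewrite [RHS]laurent_mul_sumr; apply: eq_bigr => k _.
  rewrite laurent_mulUU add0r; apply/malgP => i.
  by rewrite mcoeffZ !mcoeffU mulrnAr.
by rewrite !scaleE mulrA.
Qed.

HB.instance Definition _ :=
  GRing.Lmodule_isLalgebra.Build F (laurent F) laurent_scaleAl.
HB.instance Definition _ :=
  GRing.Lalgebra_isComAlgebra.Build F (laurent F).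

(* g(u); meaningful for u != 0, since [_ ^ k] has k : int *)
Definition laurent_eval (u : F) (g : laurent F) : F :=
  \sum_(k <- msupp g) g@_k * u ^ k.

(* g(t^-1) *)
Definition laurent_inv (g : laurent F) : laurent F :=
  \sum_(k <- msupp g) g@_k *: laurentX (- k).

End LaurentRing.

Arguments laurentX {F} k.

Local Notation "''t^' k" := (laurentX k) (at level 1, k at level 2, format "''t^' k").

(* L(gl_2). The alias carries the F-linear structure, whereas
   ['M[laurent F]_2] itself is a module over [laurent F]. *)
Definition loop_gl2 (F : fieldType) : Type := 'M[laurent F]_2.

HB.instance Definition _ (F : fieldType) :=
  GRing.NzRing.copy (loop_gl2 F) 'M[laurent F]_2.

Section LoopScale.
Variable F : fieldType.

Definition loop_scale (c : F) (x : loop_gl2 F) : loop_gl2 F :=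
  \matrix_(i, j) (c *: x i j).

Lemma loop_scaleA a b x : loop_scale a (loop_scale b x) = loop_scale (a * b) x.
Proof. by apply/matrixP => i j; rewrite !mxE scalerA. Qed.

Lemma loop_scale1 : left_id 1 loop_scale.
Proof. by move=> x; apply/matrixP => i j; rewrite !mxE scale1r. Qed.

Lemma loop_scaleDr : right_distributive loop_scale +%R.
Proof. by move=> c x y; apply/matrixP => i j; rewrite !mxE scalerDr. Qed.

Lemma loop_scaleDl x : {morph loop_scale^~ x : a b / a + b}.
Proof. by move=> a b; apply/matrixP => i j; rewrite !mxE scalerDl. Qed.

HB.instance Definition _ := GRing.Zmodule_isLmodule.Build F (loop_gl2 F)
  loop_scaleA loop_scale1 loop_scaleDr loop_scaleDl.

End LoopScale.

Section LinearAlgebra.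
Variables (F : fieldType) (V : lmodType F).
Implicit Types P Q U : V -> Prop.

Definition is_subspace P : Prop :=
  P 0 /\ forall (a : F) x y, P x -> P y -> P (a *: x + y).

Definition in_span (I : eqType) (e : I -> V) (v : V) : Prop :=
  exists (s : seq I) (c : I -> F), v = \sum_(i <- s) c i *: e i.

Definition lin_indep (I : eqType) (e : I -> V) : Prop :=
  forall (s : seq I) (c : I -> F), uniq s ->
    \sum_(i <- s) c i *: e i = 0 -> forall i, i \in s -> c i = 0.

Definition is_basis P (I : eqType) (e : I -> V) : Prop :=
  lin_indep e /\ forall v, P v <-> in_span e v.

Definition is_direct_sum U P Q : Prop :=
  (forall v, U v <-> exists p q, [/\ P p, Q q & v = p + q]) /\
  (forall p q p' q', P p -> Q q -> P p' -> Q q' ->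
     p + q = p' + q' -> p = p' /\ q = q').

End LinearAlgebra.

Definition lie_bracket (R : pzRingType) (x y : R) : R := x * y - y * x.

Section Onsager.
Variable F : fieldType.
Implicit Types (x y : loop_gl2 F) (P I : loop_gl2 F -> Prop).

Definition lie_center P x : Prop :=
  P x /\ forall y, P y -> lie_bracket x y = 0.

Definition is_lie_ideal P I : Prop :=
  [/\ is_subspace I,
      forall x, I x -> P x &
      forall x y, P x -> I y -> I (lie_bracket x y)].

Definition mx2 (a b c d : laurent F) : loop_gl2 F :=
  \matrix_(i < 2, j < 2)
    if i == 0 then (if j == 0 then a else b) else (if j == 0 then c else d).

Definition theta x : loop_gl2 F :=
  mx2 (laurent_inv (x 1 1)) (laurent_inv (x 1 0))
      (laurent_inv (x 0 1)) (laurent_inv (x 0 0)).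

Definition epsilon x : F :=
  laurent_eval 1 (x 0 0) + laurent_eval 1 (x 1 1).

Definition loop_sl2 x : Prop := \tr x = 0.

Definition ker_epsilon x : Prop := epsilon x = 0.

(* [onsager] is O and [cal_onsager] is the larger algebra \mathcal O. *)
Definition onsager x : Prop := loop_sl2 x /\ theta x = x.

Definition cal_onsager x : Prop := ker_epsilon x /\ theta x = x.

Definition cal_center : loop_gl2 F -> Prop := lie_center cal_onsager.

Definition calA (k : int) : loop_gl2 F := mx2 0 't^k 't^(- k) 0.

Definition calB (k : int) : loop_gl2 F :=
  mx2 ('t^k - 1) 0 0 ('t^(- k) - 1).

End Onsager.

Arguments calA {F} k.
Arguments calB {F} k.

Definition posnat : Type := {k : nat | (0 < k)%N}.
HB.instance Definition _ := Equality.on posnat.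

Definition onsager_basis (F : fieldType) (i : int + posnat) : loop_gl2 F :=
  match i with
  | inl k => calA k
  | inr k => 2%:R^-1 *: (calB (val k)%:Z - calB (- (val k)%:Z))
  end.

Definition center_basis (F : fieldType) (k : posnat) : loop_gl2 F :=
  2%:R^-1 *: (calB (val k)%:Z + calB (- (val k)%:Z)).

(* Main.v *)
From HB Require Import structures.
Require Import Defs.
From mathcomp Require Import all_boot all_order all_algebra.
From mathcomp Require Import finmap zify ring.
From mathcomp.multinomials Require Import monalg.

Import GRing.Theory.
Local Open Scope ring_scope.

(** An element of the loop algebra is fixed by [theta] exactly when its bottom
    row is the image of its top row under the inversion of t: x is determined
    by a = x_00 and b = x_01, with x_11 = a(t^-1) and x_10 = b(t^-1)
    ([theta_fixedP]).

    Both bases are obtained from one criterion ([dual_family_basis]): a family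
    lying in a subspace is a basis of it as soon as there are coordinate forms,
    dual to the family, that separate the points of the subspace and of which
    only finitely many are nonzero at any given vector.  For O, where moreover
    a(t^-1) = - a(t), the forms are the coefficients of b and twice the
    positive coefficients of a; antisymmetry recovers the other coefficients
    of a.

    The key point for the rest is that the center consists of the scalar
    matrices p I with p(t^-1) = p(t) and p(1) = 0 ([cal_centerP]).
    Commuting with A_0 forces x_00 = x_11 and x_01 = x_10, and then commuting
    with A_k makes the coefficients of x_01 periodic of period 2k.  A Laurent
    polynomial has finite support, so x_01 = 0.  Twice the positive
    coefficients of p are dual to the elements (B_k + B_{-k})/2; if they all
    vanish then p is a constant by symmetry, and this constant is p(1) = 0.

    Finally, x = (x - (tr x / 2) I) + (tr x / 2) I splits an element of the
    larger algebra into a traceless part and a central part, uniquely, because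
    a traceless scalar matrix is zero in characteristic other than 2.  The
    ideal property holds because commutators are traceless and [theta] is
    multiplicative. *)

(** * Bases from dual families *)

Section DualBasis.
Variables (F : fieldType) (V : lmodType F) (P : V -> Prop).
Variables (I : eqType) (e : I -> V) (phi : I -> {scalar V}).

Lemma subspace_sum (J : Type) (s : seq J) (c : J -> F) (f : J -> V) :
  is_subspace P -> (forall j, P (f j)) -> P (\sum_(j <- s) c j *: f j).
Proof.
move=> [P0 PD] Pf; elim: s => [|j s IH]; first by rewrite big_nil.
by rewrite big_cons; exact: PD.
Qed.

(** The vector [\sum_(i <- s) phi i v *: e i], with [s] containing the support
    of [v], has the same coordinates as [v], so that [sep] identifies the
    two. *)
Lemma dual_family_basis :
    is_subspace P ->
    (forall i, P (e i)) ->
    (forall i j, phi i (e j) = (i == j)%:R) ->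
    (forall v, exists s : seq I, forall i, phi i v != 0 -> i \in s) ->
    (forall v, P v -> (forall i, phi i v = 0) -> v = 0) ->
  is_basis P e.
Proof.
move=> subP Pe dual fin_supp sep.
have phi_sum s c i : uniq s ->
    phi i (\sum_(j <- s) c j *: e j) = if i \in s then c i else 0.
  move=> s_uniq; rewrite linear_sum /=.
  case: ifP => [i_s|/negbT i_s].
    rewrite (bigD1_seq i) //= linearZ /= dual eqxx mulr1 big1 ?addr0 // => j ji.
    by rewrite linearZ /= dual eq_sym (negbTE ji) mulr0.
  rewrite big_seq big1 // => j j_s; rewrite linearZ /= dual.
  by case: eqP i_s => [->|_ _]; rewrite ?j_s // mulr0.
split=> [s c s_uniq s0 i i_s|v].
  by have := phi_sum s c i s_uniq; rewrite s0 linear0 i_s.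
split=> [Pv|[s [c ->]]]; last exact: subspace_sum.
have [s supp_s] := fin_supp v.
(* A repeated index would be counted twice in the sum, hence [undup]. *)
exists (undup s), (fun i => phi i v); apply/eqP; rewrite -subr_eq0; apply/eqP.
apply: sep => [|i].
  have [_ PD] := subP; rewrite addrC -scaleN1r.
  by apply: PD => //; exact: subspace_sum.
rewrite linearB /= phi_sum ?undup_uniq // mem_undup.
case: ifP => [_|/negbT i_s]; first by rewrite subrr.
by rewrite subr0; apply/eqP; apply: contraNT i_s; exact: supp_s.
Qed.

End DualBasis.

(** * Laurent polynomials *)

Section Laurent.
Variable F : fieldType.
Implicit Types (g h : laurent F) (k : int).

(** Sums and multiples in [laurent F] are those of its own module structure, so
    the coefficient rules are restated at that type for rewriting. *)
Lemma laurent_coeffD g h k : (g + h)@_k = g@_k + h@_k.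
Proof. exact: mcoeffD. Qed.

Lemma laurent_coeffZ (c : F) g k : (c *: g)@_k = c * g@_k.
Proof. exact: mcoeffZ. Qed.

Lemma laurent_coeffN g k : (- g)@_k = - g@_k.
Proof. exact: mcoeffN. Qed.

Lemma laurent_coeff0 k : (0 : laurent F)@_k = 0.
Proof. exact: mcoeff0. Qed.

Lemma laurent_coeffX l k : (laurentX l : laurent F)@_k = (l == k)%:R.
Proof. by rewrite mcoeffU. Qed.

Lemma laurent_coeff1 k : (1 : laurent F)@_k = (0 == k)%:R.
Proof. exact: laurent_coeffX. Qed.

Definition laurent_coeffE :=
  (laurent_coeffD, laurent_coeffN, laurent_coeffZ, laurent_coeffX,
   laurent_coeff1, laurent_coeff0).

Lemma laurentP g h : (forall k, g@_k = h@_k) -> g = h.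
Proof. by move=> gh; apply/(@malgP _ F). Qed.

Lemma laurent_scaleX (c : F) k : c *: laurentX k = (<< c *g k >> : laurent F).
Proof. by apply: laurentP => i; rewrite laurent_coeffZ !mcoeffU mulr_natr. Qed.

Lemma laurentXD k l : laurentX k * laurentX l = laurentX (k + l) :> laurent F.
Proof. by rewrite [LHS]laurent_mulUU mulr1. Qed.

Lemma laurent_coeffXM l g k : (laurentX l * g)@_k = g@_(k - l).
Proof.
rewrite [g in LHS]laurentE mulr_sumr raddf_sum [g in RHS]laurentE raddf_sum /=.
apply: eq_bigr => i _; rewrite [_ * _]laurent_mulUU mul1r !mcoeffU.
by congr (_ *+ _); lia.
Qed.

(** Only the existence of a bound matters, and the sum of all the exponents'
    absolute values is one that needs no case distinction on the support. *)
Lemma laurent_bounded g :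
  exists n : nat, forall k, g@_k != 0 -> (`|k| <= n)%N.
Proof.
exists (\sum_(k <- msupp g) `|k|)%N => k.
by rewrite mcoeff_neq0 => k_g; rewrite (big_fsetD1 k k_g) /= leq_addr.
Qed.

Lemma laurent_inv_coeff g k : (laurent_inv g)@_k = g@_(- k).
Proof.
rewrite [RHS](congr1 (mcoeff _) (laurentE g)) !raddf_sum /=.
apply: eq_bigr => i _; rewrite laurent_coeffZ !mcoeffU mulr_natr.
by congr (_ *+ _); lia.
Qed.

Lemma laurent_inv_is_zmod_morphism : zmod_morphism (@laurent_inv F).
Proof.
move=> g h; apply: laurentP => k.
by rewrite !(laurent_inv_coeff, laurent_coeffE).
Qed.

Lemma laurent_invX k : laurent_inv (laurentX k) = laurentX (- k) :> laurent F.
Proof.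
apply: laurentP => i; rewrite laurent_inv_coeff !laurent_coeffE.
by congr (_ *+ _); lia.
Qed.

HB.instance Definition _ := GRing.isZmodMorphism.Build (laurent F) (laurent F)
  (@laurent_inv F) laurent_inv_is_zmod_morphism.

Lemma laurent_inv_is_scalable : scalable (@laurent_inv F).
Proof.
move=> c g; apply: laurentP => k.
by rewrite !(laurent_inv_coeff, laurent_coeffE).
Qed.

HB.instance Definition _ := GRing.isScalable.Build F (laurent F) (laurent F)
  _ (@laurent_inv F) laurent_inv_is_scalable.

Lemma laurent_inv_is_monoid_morphism : monoid_morphism (@laurent_inv F).
Proof.
split=> [|g h]; first by rewrite [LHS]laurent_invX oppr0.
rewrite [X in laurent_inv (X * _)]laurentE [X in laurent_inv (_ * X)]laurentE.
rewrite mulr_suml linear_sum mulr_suml; apply: eq_bigr => k _.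
rewrite mulr_sumr linear_sum mulr_sumr; apply: eq_bigr => l _ /=.
rewrite -!laurent_scaleX -scalerAl -scalerAr laurentXD !linearZ /=.
by rewrite laurent_invX -scalerAl -scalerAr laurentXD opprD.
Qed.

HB.instance Definition _ := GRing.isMonoidMorphism.Build (laurent F) (laurent F)
  (@laurent_inv F) laurent_inv_is_monoid_morphism.

Lemma laurent_invK : involutive (@laurent_inv F).
Proof. by move=> g; apply: laurentP => k; rewrite !laurent_inv_coeff opprK. Qed.

(** Enlarging the summation domain lets Laurent polynomials with different
    supports be evaluated over a common one. *)
Lemma laurent_evalw (u : F) (d : {fset int}) g : (msupp g `<=` d)%fset ->
  laurent_eval u g = \sum_(k <- d) g@_k * u ^ k.
Proof.
move=> le_d; apply: big_fset_incl => // k _ /mcoeff_outdom ->.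
by rewrite mul0r.
Qed.

Lemma laurent_eval_is_linear (u : F) : scalar (laurent_eval u).
Proof.
move=> c g h; pose d := (msupp (c *: g + h) `|` (msupp g `|` msupp h))%fset.
rewrite !(@laurent_evalw u d) /d ?fsubsetUl //; last 2 first.
- by rewrite fsubsetU // fsubsetUr orbT.
- by rewrite fsubsetU // fsubsetUl orbT.
rewrite big_distrr -big_split /=; apply: eq_bigr => k _.
by rewrite !laurent_coeffE mulrDl mulrA.
Qed.

HB.instance Definition _ (u : F) := GRing.isLinear.Build F (laurent F) F
  _ (laurent_eval u) (laurent_eval_is_linear u).

Lemma laurent_evalX (u : F) k : laurent_eval u (laurentX k) = u ^ k.
Proof.
rewrite (@laurent_evalw u _ _ msuppU_le) big_seq_fset1.
by rewrite laurent_coeffE eqxx mul1r.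
Qed.

Lemma laurent_eval1_inv g : laurent_eval 1 (laurent_inv g) = laurent_eval 1 g.
Proof.
(* [laurent_inv] is by definition a sum over the support. *)
rewrite [g in RHS]laurentE [LHS]linear_sum [RHS]linear_sum.
apply: eq_bigr => k _ /=.
by rewrite -laurent_scaleX !linearZ /= !laurent_evalX !exp1rz.
Qed.

End Laurent.

(** * Loop matrices and the two algebras *)

Section Loop.
Variable F : fieldType.
Implicit Types (x y : loop_gl2 F) (p : laurent F) (k : int).

Lemma loop_ext x y :
  x 0 0 = y 0 0 -> x 0 1 = y 0 1 -> x 1 0 = y 1 0 -> x 1 1 = y 1 1 -> x = y.
Proof.
move=> e00 e01 e10 e11; apply/matrixP => i j.
have ord2 (l : 'I_2) : l = 0 \/ l = 1.
  by case: l => -[|[|//]] ?; [left|right]; exact/val_inj.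
by have [->|->] := ord2 i; have [->|->] := ord2 j.
Qed.

Lemma loopD_coef x y i j : (x + y) i j = x i j + y i j.
Proof. by rewrite mxE. Qed.

Lemma loopN_coef x i j : (- x) i j = - x i j.
Proof. by rewrite mxE. Qed.

Lemma loop0_coef i j : (0 : loop_gl2 F) i j = 0.
Proof. by rewrite mxE. Qed.

Lemma loopZ_coef (c : F) x i j : (c *: x) i j = c *: x i j.
Proof. by rewrite mxE. Qed.

Lemma loopM_coef x y i j : (x * y) i j = x i 0 * y 0 j + x i 1 * y 1 j.
Proof.
rewrite [LHS]mxE big_ord_recl big_ord1.
by congr (_ + x _ _ * y _ _); exact/val_inj.
Qed.

Lemma mx2_coef (a b c d : laurent F) :
  (mx2 a b c d 0 0 = a) * (mx2 a b c d 0 1 = b) *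
  (mx2 a b c d 1 0 = c) * (mx2 a b c d 1 1 = d).
Proof. by rewrite !mxE. Qed.

Lemma theta_coef x :
  (theta x 0 0 = laurent_inv (x 1 1)) * (theta x 0 1 = laurent_inv (x 1 0)) *
  (theta x 1 0 = laurent_inv (x 0 1)) * (theta x 1 1 = laurent_inv (x 0 0)).
Proof. by rewrite !mx2_coef. Qed.

Definition loop_coefE :=
  (loopD_coef, loopN_coef, loopZ_coef, loop0_coef, loopM_coef,
   mx2_coef, theta_coef).

Definition loop_coord (a : F) (i j : 'I_2) k x : F := a * (x i j)@_k.

Lemma loop_coord_is_linear a i j k : scalar (loop_coord a i j k).
Proof.
move=> c x y; rewrite /loop_coord loopD_coef loopZ_coef.
by rewrite laurent_coeffD laurent_coeffZ mulrDr mulrCA.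
Qed.

HB.instance Definition _ a i j k := GRing.isLinear.Build F (loop_gl2 F) F
  _ (loop_coord a i j k) (loop_coord_is_linear a i j k).

(** Linear and multiplicative, because [theta] is inversion of t applied to the
    entries, followed by conjugation by the matrix exchanging the two basis
    vectors. *)
Lemma theta_is_linear : linear (@theta F).
Proof.
by move=> c x y; apply: loop_ext; rewrite !loop_coefE linearP.
Qed.

HB.instance Definition _ := GRing.isLinear.Build F (loop_gl2 F) (loop_gl2 F)
  _ (@theta F) theta_is_linear.

Lemma thetaM x y : theta (x * y) = theta x * theta y.
Proof.
by apply: loop_ext; rewrite theta_coef !loopM_coef !theta_coef;
  rewrite rmorphD !rmorphM; exact: addrC.
Qed.

Lemma theta_fixedP x :
  theta x = x <->
  x 1 1 = laurent_inv (x 0 0) /\ x 1 0 = laurent_inv (x 0 1).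
Proof.
split=> [xE|[x11 x10]]; first by split; rewrite -[in LHS]xE loop_coefE.
by apply: loop_ext; rewrite !loop_coefE ?x11 ?x10 ?laurent_invK.
Qed.

Lemma loop_trE x : \tr x = x 0 0 + x 1 1.
Proof.
rewrite /mxtrace big_ord_recl big_ord1.
by congr (_ + x _ _); exact/val_inj.
Qed.

(** In this form epsilon visibly vanishes on traceless matrices. *)
Lemma epsilonE x : epsilon x = laurent_eval 1 (\tr x).
Proof. by rewrite loop_trE linearD. Qed.

Lemma theta_fixed_subspace (P : loop_gl2 F -> Prop) :
  is_subspace P -> is_subspace (fun x => P x /\ theta x = x).
Proof.
move=> [P0 PD]; split=> [|c x y [Px xE] [Py yE]].
  by rewrite linear0.
by split; [exact: PD|rewrite linearP /= xE yE].
Qed.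

Lemma onsager_subspace : is_subspace (@onsager F).
Proof.
apply: theta_fixed_subspace; split=> [|c x y].
  by rewrite /loop_sl2 mxtrace0.
rewrite /loop_sl2 !loop_trE !loop_coefE => trx try.
by rewrite addrACA -scalerDr trx try scaler0 addr0.
Qed.

Lemma cal_onsager_subspace : is_subspace (@cal_onsager F).
Proof.
apply: theta_fixed_subspace; split=> [|c x y].
  by rewrite /ker_epsilon epsilonE mxtrace0 linear0.
rewrite /ker_epsilon !epsilonE !loop_trE !loop_coefE => ex ey.
by rewrite addrACA -scalerDr linearP /= ex ey mulr0 addr0.
Qed.

Lemma onsager_sub_cal x : onsager x -> cal_onsager x.
Proof.
by move=> [trx xE]; split=> //; rewrite /ker_epsilon epsilonE trx linear0.
Qed.

Lemma onsager_ideal : is_lie_ideal (@cal_onsager F) (@onsager F).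
Proof.
split=> [||x y [_ xE] [_ yE]]; first exact: onsager_subspace.
  exact: onsager_sub_cal.
split; first by rewrite /loop_sl2 raddfB /= mxtrace_mulC subrr.
by rewrite linearB /= !thetaM xE yE.
Qed.

Lemma calA_onsager k : onsager (@calA F k).
Proof.
split; first by rewrite /loop_sl2 loop_trE !loop_coefE addr0.
by apply/theta_fixedP; rewrite !loop_coefE linear0 laurent_invX.
Qed.

(** * The center *)

Definition loop_scalar p : loop_gl2 F := mx2 p 0 0 p.

Lemma loop_scalar_commute p y : loop_scalar p * y = y * loop_scalar p.
Proof. by apply: loop_ext; rewrite !loop_coefE; ring. Qed.

(** A central element commutes with every A_k; each of these relations says that
    the off-diagonal part is 2k-periodic, which finite support rules out unless
    that part is zero. *)
Lemma cal_centerP (two_neq0 : 2 != 0 :> F) x :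
  cal_center x <->
  exists p, [/\ laurent_inv p = p, laurent_eval 1 p = 0 & x = loop_scalar p].
Proof.
split=> [[[ex xE] cx]|[p [pE p1 ->]]]; last first.
  split=> [|y _]; last by rewrite /lie_bracket loop_scalar_commute subrr.
  split; first by rewrite /ker_epsilon /epsilon !loop_coefE p1 addr0.
  by apply/theta_fixedP; rewrite !loop_coefE linear0.
have [x11 x10] := proj1 (theta_fixedP x) xE.
have cA k : x * calA k = calA k * x.
  by apply/eqP; rewrite -subr_eq0; apply/eqP/cx/onsager_sub_cal/calA_onsager.
have cA00 k : laurentX (- k) * x 0 1 = laurentX k * x 1 0.
  have := congr1 (fun z : loop_gl2 F => z 0 0) (cA k).
  by rewrite /= !loop_coefE mulr0 add0r mul0r add0r mulrC.
have cA01 : x 0 0 = x 1 1.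
  have := congr1 (fun z : loop_gl2 F => z 0 1) (cA 0).
  by rewrite /= !loop_coefE mulr0 addr0 mul0r add0r !(mul1r, mulr1).
(* Entry (0,0) of x A_k = A_k x, with x_10 = x_01, reads
   t^-k x_01 = t^k x_01. *)
have x01_period k l : (x 0 1)@_(l + k + k) = (x 0 1)@_l.
  have x01E : x 0 1 = x 1 0 by have := cA00 0; rewrite !mul1r.
  have := congr1 (mcoeff (l + k)) (cA00 k).
  rewrite -x01E !laurent_coeffXM => E.
  by rewrite [l + k + k](_ : _ = l + k - - k) ?E //; [congr (_@__)|]; lia.
have x01 : x 0 1 = 0.
  apply: laurentP => l; rewrite laurent_coeff0.
  have [n n_bound] := laurent_bounded F (x 0 1).
  apply/eqP/negPn/negP => x01l.
  (* Shifting by 2(n+1) carries an exponent of absolute value at most n outside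
     [-n, n]. *)
  have := n_bound l x01l; have := n_bound (l + n.+1%:Z + n.+1%:Z).
  by rewrite x01_period x01l => /(_ isT); lia.
exists (x 0 0); split; first by rewrite -x11.
  have := ex; rewrite /ker_epsilon /epsilon -cA01 -mulr2n -mulr_natl => /eqP.
  by rewrite mulf_eq0 (negbTE two_neq0) => /eqP.
by apply: loop_ext; rewrite !loop_coefE // x10 x01 linear0.
Qed.

Lemma cal_center_subspace (two_neq0 : 2 != 0 :> F) :
  is_subspace (@cal_center F).
Proof.
split=> [|c x y]; first split=> [|y _].
- by have [] := cal_onsager_subspace.
- by rewrite /lie_bracket mul0r mulr0 subrr.
move=> /(cal_centerP two_neq0)[p [pE p1 ->]].
move=> /(cal_centerP two_neq0)[q [qE q1 ->]].
apply/(cal_centerP two_neq0); exists (c *: p + q); split.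
- by rewrite linearP /= pE qE.
- by rewrite linearP /= p1 q1 mulr0 addr0.
- by apply: loop_ext; rewrite !loop_coefE // scaler0 addr0.
Qed.

(** * The bases and the decomposition *)

(** Supplies the finiteness hypothesis of [dual_family_basis] for coordinates
    indexed by [posnat], [f] being the coefficients of a Laurent polynomial. *)
Lemma posnat_support (f : int -> F) (n : nat) :
    (forall k, f k != 0 -> (`|k| <= n)%N) ->
  exists s : seq posnat, forall k : posnat, f (val k)%:Z != 0 -> k \in s.
Proof.
move=> fn; exists (pmap (insub : nat -> option posnat) (iota 0 n.+1)) => k fk.
by rewrite mem_pmap_sub mem_iota; exact: fn fk.
Qed.

Lemma calB_coeff_pos (k l : posnat) :
  (calB (val l)%:Z 0 0 : laurent F)@_(val k)%:Z = (k == l)%:R.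
Proof.
rewrite !loop_coefE !laurent_coeffE.
case: k l => [k k_gt0] [l l_gt0] /=.
rewrite [0 == _](_ : _ = false); last by lia.
by rewrite subr0 [(_ == _ :> posnat)](_ : _ = (k == l)) // eq_sym.
Qed.

Lemma calB_coeff_neg (k l : posnat) :
  (calB (- (val l)%:Z) 0 0 : laurent F)@_(val k)%:Z = 0.
Proof.
rewrite !loop_coefE !laurent_coeffE.
case: k l => [k k_gt0] [l l_gt0] /=.
rewrite [0 == _](_ : _ = false); last by lia.
by rewrite [_ == _](_ : _ = false) ?subr0 //; lia.
Qed.

Lemma theta_calB k : theta (calB k) = calB k :> loop_gl2 F.
Proof.
apply/theta_fixedP; rewrite !loop_coefE linear0; split=> //.
by rewrite linearB /= laurent_invX rmorph1.
Qed.

(** The factor 2 compensates for the 1/2 in (B_k - B_{-k})/2, whose (0,0) entry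
    is (t^k - t^-k)/2. *)
Definition onsager_coord (i : int + posnat) : {scalar loop_gl2 F} :=
  match i with
  | inl k => loop_coord 1 0 1 k
  | inr k => loop_coord 2 0 0 (val k)%:Z
  end.

(** In O the entry a = x_00 satisfies a(t^-1) = - a(t): its negative
    coefficients are determined by the positive ones, and its constant term is
    equal to its own opposite. *)
Lemma onsager_is_basis (two_neq0 : 2 != 0 :> F) :
  is_basis (@onsager F) (@onsager_basis F).
Proof.
apply: (@dual_family_basis _ _ _ _ _ onsager_coord).
- exact: onsager_subspace.
- case=> [k|k]; first exact: calA_onsager.
  split; last by rewrite linearZ linearB /= !theta_calB.
  rewrite /loop_sl2 loop_trE !loop_coefE opprK -scalerDr.
  by rewrite [_ + _ + (_ + _)](_ : _ = 0) ?scaler0 //; ring.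
- move=> [k|k] [l|l]; rewrite /= /loop_coord.
  + by rewrite mx2_coef mul1r laurent_coeffX eq_sym.
  + by rewrite !loop_coefE subrr scaler0 laurent_coeff0 mulr0.
  + by rewrite mx2_coef laurent_coeff0 mulr0.
  + rewrite loopZ_coef loopD_coef loopN_coef.
    rewrite laurent_coeffZ laurent_coeffD laurent_coeffN.
    by rewrite calB_coeff_pos calB_coeff_neg subr0 mulVKf.
- move=> x; have [n n_bound] := laurent_bounded F (x 0 0).
  have [s s_supp] := posnat_support _ _ n_bound.
  exists (map inl (msupp (x 0 1)) ++ map inr s) => -[k|k].
    by rewrite /= /loop_coord mul1r mem_cat mcoeff_neq0 => k_x; rewrite map_f.
  rewrite /= mem_cat mulf_eq0 negb_or => /andP[_ /s_supp k_s].
  by rewrite orbC map_f.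
- move=> x [trx /theta_fixedP[x11 x10]] coord0.
  have x01 : x 0 1 = 0.
    apply: laurentP => k; rewrite laurent_coeff0 -[LHS]mul1r.
    exact: (coord0 (inl k)).
  have x00_pos (k : posnat) : (x 0 0)@_(val k)%:Z = 0.
    by have /eqP := coord0 (inr k); rewrite mulf_eq0 (negbTE two_neq0) => /eqP.
  have x00_odd k : (x 0 0)@_k + (x 0 0)@_(- k) = 0.
    have := congr1 (mcoeff k) trx.
    by rewrite loop_trE x11 laurent_coeffD laurent_inv_coeff laurent_coeff0.
  have x00 : x 0 0 = 0.
    apply: laurentP => -[[|k]|k]; rewrite laurent_coeff0.
    + apply/eqP; have /eqP := x00_odd 0.
      by rewrite oppr0 -mulr2n -mulr_natl mulf_eq0 (negbTE two_neq0).
    + exact: (x00_pos (exist _ k.+1 isT)).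
    + have := x00_odd (Negz k).
      by rewrite (x00_pos (exist _ k.+1 isT)) addr0.
  by apply: loop_ext; rewrite ?x11 ?x10 ?x00 ?x01 ?linear0 loop_coefE.
Qed.

Definition center_coord (k : posnat) : {scalar loop_gl2 F} :=
  loop_coord 2 0 0 (val k)%:Z.

(** A central scalar p is symmetric, so if its positive coefficients vanish it
    is constant, and then p(1) = 0 makes it zero: this is where the condition on
    epsilon is needed. *)
Lemma center_is_basis (two_neq0 : 2 != 0 :> F) :
  is_basis (@cal_center F) (@center_basis F).
Proof.
apply: (@dual_family_basis _ _ _ _ _ center_coord).
- exact: cal_center_subspace.
- move=> k; apply/(cal_centerP two_neq0); exists (center_basis F k 0 0).
  rewrite !loop_coefE; split.
  + rewrite linearZ linearD !linearB /= rmorph1 !laurent_invX opprK.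
    by rewrite addrC.
  + rewrite linearZ linearD !linearB /= !laurent_evalX !exp1rz.
    by rewrite subrr addr0 mulr0.
  + by apply: loop_ext; rewrite !loop_coefE ?addr0 ?scaler0 // opprK addrC.
- move=> k l; rewrite /= /loop_coord loopZ_coef loopD_coef.
  rewrite laurent_coeffZ laurent_coeffD.
  by rewrite calB_coeff_pos calB_coeff_neg addr0 mulVKf.
- move=> x; have [n n_bound] := laurent_bounded F (x 0 0).
  have [s s_supp] := posnat_support _ _ n_bound.
  by exists s => k; rewrite /= mulf_eq0 negb_or => /andP[_ /s_supp].
- move=> x /(cal_centerP two_neq0)[p [pE p1 ->]] coord0.
  have p_pos (k : posnat) : p@_(val k)%:Z = 0.
    have /eqP := coord0 k.
    by rewrite /= /loop_coord !loop_coefE mulf_eq0 (negbTE two_neq0) => /eqP.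
  have p_const : p = p@_0 *: laurentX 0.
    apply: laurentP => -[[|k]|k]; rewrite !laurent_coeffE ?mulr1 ?mulr0 //.
    + exact: (p_pos (exist _ k.+1 isT)).
    + by rewrite -pE laurent_inv_coeff; exact: (p_pos (exist _ k.+1 isT)).
  have p0 : p = 0.
    move: p1; rewrite p_const linearZ /= laurent_evalX mulr1 => ->.
    by rewrite scale0r.
  by apply: loop_ext; rewrite !loop_coefE // p0.
Qed.

(** Half the trace, as a scalar matrix, is the central component; it lies in the
    center since tr x = a(t) + a(t^-1) is symmetric and vanishes at t = 1. *)
Lemma onsager_center_direct_sum (two_neq0 : 2 != 0 :> F) :
  is_direct_sum (@cal_onsager F) (@onsager F) (@cal_center F).
Proof.
have [_ OD] := onsager_subspace; have [_ ZD] := cal_center_subspace two_neq0.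
have [_ calD] := cal_onsager_subspace.
split=> [x|x z x' z' Ox Zz Ox' Zz' xz].
  split=> [[ex xE]|[y [z [Oy [Oz _] ->]]]]; last first.
    by rewrite -[y]scale1r; apply: calD => //; exact: onsager_sub_cal.
  pose p := 2^-1 *: \tr x.
  have Zp : cal_center (loop_scalar p).
    apply/(cal_centerP two_neq0); exists p; split=> //.
      have [x11 _] := proj1 (theta_fixedP x) xE.
      by rewrite /p linearZ /= loop_trE linearD /= x11 laurent_invK addrC.
    by rewrite /p linearZ /= -epsilonE ex mulr0.
  exists (x - loop_scalar p), (loop_scalar p).
  split=> //; last by rewrite subrK.
  split; last by have [[_ pE] _] := Zp; rewrite linearB /= xE pE.
  have pp : p + p = \tr x.
    by rewrite -mulr2n -scaler_nat scalerA mulfV // scale1r.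
  by rewrite /loop_sl2 raddfB /= [X in _ - X]loop_trE !loop_coefE pp subrr.
(* The difference of two decompositions is both central and traceless. *)
have zx : z' - z = x - x'.
  by apply/eqP; rewrite subr_eq addrAC eq_sym subr_eq xz addrC.
have : cal_center (z' - z) by rewrite addrC -scaleN1r; exact: ZD.
have : onsager (z' - z) by rewrite zx addrC -scaleN1r; exact: OD.
move=> [+ _] => /[swap] /(cal_centerP two_neq0)[p [_ _ zp]].
rewrite /loop_sl2 zp loop_trE !loop_coefE => pp.
have p0 : p = 0.
  have /eqP : (2 : F) *: p = 0 by rewrite scaler_nat mulr2n.
  by rewrite scaler_eq0 (negbTE two_neq0) => /eqP.
have scalar0 : loop_scalar p = 0 by apply: loop_ext; rewrite !loop_coefE.
split; first by apply: subr0_eq; rewrite -zx zp.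
by apply/esym/subr0_eq; rewrite zp.
Qed.

End Loop.

Lemma pchar0_two_neq0 (F : fieldType) : [pchar F] =i pred0 -> 2 != 0 :> F.
Proof. by move=> /pcharf0P ->. Qed.

Theorem lemma4p9 (F : fieldType) (charF0 : [pchar F] =i pred0) :
  [/\ is_basis (@onsager F) (@onsager_basis F),
      is_basis (@cal_center F) (@center_basis F),
      is_direct_sum (@cal_onsager F) (@onsager F) (@cal_center F) &
      is_lie_ideal (@cal_onsager F) (@onsager F)].
Proof.
have two_neq0 := pchar0_two_neq0 F charF0.
split; last exact: onsager_ideal.
- exact: onsager_is_basis.
- exact: center_is_basis.
- exact: onsager_center_direct_sum.
Qed.
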